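(* Let $E=([-1,1]\times\{0\})\cup(\{0\}\times[0,1])\subset\mathbb{R}^2$. Then \begin{itemize} \item $E$ does not have a weak approximate $1$-tangent at $0$, \item $\mathcal{U}_{p}^{1}(E)<\infty$ for all $p\in(0,1)$, \item $\mathcal{I}_{p}^{1}(E)<\infty$ for all $p\in(0,2)$, \item $\mathcal{M}_{p}^{1}(E)<\infty$ for all $p\in(0,3)$. \end{itemize}
   Context: $\mathcal{H}^1$ is the one-dimensional Hausdorff measure. For mutually distinct points $x,y,z$ let $r(x,y,z)\in(0,\infty]$ be the circumradius of the triangle with these vertices ($r=\infty$ if the points are collinear). Conventions: $1/0=\infty$, $1/\infty=0$, $\inf\emptyset=\infty$. For a set $X$ put $\kappa(x,y,z)=1/r(x,y,z)$ if $x,y,z\in X$ are mutually distinct and $0$ otherwise; $\kappa_i(x,y)=1/\inf_{w\in X\setminus\{x,y\}} r(x,y,w)$ if $x\neq y$ and $\kappa_i(x,x)=0$; $\kappa_G(x)=1/\inf\{r(x,v,w): v,w\in X,\ x,v,w\text{ mutually distinct}\}$. For $p\in(0,\infty)$: $\mathcal{U}_p^{1}(X)=\int_X\kappa_G^p\,d\mathcal{H}^1$, $\mathcal{I}_p^{1}(X)=\int_X\int_X\kappa_i^p(x,y)\,d\mathcal{H}^1(x)d\mathcal{H}^1(y)$, $\mathcal{M}_p^{1}(X)=\int_X\int_X\int_X\kappa^p(x,y,z)\,d\mathcal{H}^1(x)d\mathcal{H}^1(y)d\mathcal{H}^1(z)$. For $s\in\mathbb{S}^{n-1}$, $\epsilon>0$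 the open double cone is $C_{s,\epsilon}(x)=\{y\in\mathbb{R}^n\setminus\{x\}:\min\{\measuredangle(y,x,x-s),\measuredangle(y,x,x+s)\}<\epsilon\}$, where $\measuredangle(y,x,z)$ is the angle at $x$. A set $X\subset\mathbb{R}^n$ has a weak approximate $1$-tangent at $x$ if there are $\rho>0$ and a mapping $s:(0,\rho)\to\mathbb{S}^{n-1}$ such that $\lim_{r\downarrow0}\mathcal{H}^1([X\setminus C_{s(r),\epsilon}(x)]\cap\overline B_r(x))/(2r)=0$ for all $\epsilon>0$, where $\overline B_r(x)$ is the closed ball. *)

(* Defs.v *)
From HB Require Import structures.
From mathcomp Require Import all_boot all_order all_algebra.
From mathcomp Require Import all_classical all_reals all_analysis.

Set Implicit Arguments.
Unset Strict Implicit.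
Unset Printing Implicit Defensive.

Import Order.TTheory GRing.Theory Num.Theory.
Import numFieldNormedType.Exports.

Local Open Scope classical_set_scope.
Local Open Scope ring_scope.

(* The norm that the library puts on 'rV[R]_n is the sup norm, hence the
   Euclidean notions below. *)
Section euclidean.
Context {R : realType} {n : nat}.
Implicit Types (x y z s u v : 'rV[R]_n) (A : set 'rV[R]_n) (r eps : R).

Definition edot u v : R := \sum_(i < n) u ord0 i * v ord0 i.

Definition enorm u : R := Num.sqrt (edot u u).

Definition edist x y : R := enorm (x - y).

Definition eclosed_ball x r : set 'rV[R]_n := [set y | edist y x <= r].

Definition esphere : set 'rV[R]_n := [set s | enorm s = 1].

(* The vertex is the middle argument. *)
Definition angle y x z : R :=
  acos (edot (y - x) (z - x) / (enorm (y - x) * enorm (z - x))).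

Definition double_cone s eps x : set 'rV[R]_n :=
  [set y | y != x /\ Num.min (angle y x (x - s)) (angle y x (x + s)) < eps].

(* The maximum with 0 only matters for A = set0, where the supremum is -oo. *)
Definition diam A : \bar R :=
  maxe 0%E (ereal_sup [set (edist p.1 p.2)%:E | p in A `*` A]).

End euclidean.

Section hausdorff.
Context {R : realType} {n : nat}.
Implicit Types (A B : set 'rV[R]_n) (F : (set 'rV[R]_n)^nat) (delta : R).
Local Open Scope ereal_scope.
Local Open Scope measure_display_scope.

Definition delta_cover delta A : set (set 'rV[R]_n)^nat :=
  [set F | (forall k, diam (F k) <= delta%:E) /\ A `<=` \bigcup_k F k].

Definition hausdorff1_delta delta A : \bar R :=
  ereal_inf [set \sum_(k <oo) diam (F k) | F in delta_cover delta A].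

Definition hausdorff1 A : \bar R :=
  ereal_sup [set hausdorff1_delta delta A | delta in [set d : R | (0 < d)%R]].

Lemma diam_ge0 A : 0 <= diam A.
Proof. by rewrite /diam le_max lexx. Qed.

Lemma diam0 : diam (@set0 'rV[R]_n) = 0.
Proof.
rewrite /diam (_ : [set _ | _ in _] = set0) ?ereal_sup0 ?maxeNy//.
by apply/seteqP; split => // x [p [/= []]].
Qed.

Lemma hausdorff1_delta_ge0 delta A : 0 <= hausdorff1_delta delta A.
Proof.
apply: le_ereal_inf_tmp => _ [F _ <-].
by apply: nneseries_ge0 => k _ _; exact: diam_ge0.
Qed.

Lemma hausdorff1_delta0 delta : (0 < delta)%R -> hausdorff1_delta delta set0 = 0.
Proof.
move=> d0; apply/eqP; rewrite eq_le hausdorff1_delta_ge0 andbT.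
apply: ereal_inf_lbound; exists (fun=> set0).
  by split => // k; rewrite diam0 lee_fin ltW.
by rewrite eseries0// => k _ _; rewrite diam0.
Qed.

Lemma le_hausdorff1_delta delta :
  {homo hausdorff1_delta delta : A B / A `<=` B >-> A <= B}.
Proof.
move=> A B AB; apply/ereal_inf_le_tmp => _ [F [dF BF] <-].
by exists F => //; split => //; exact: subset_trans BF.
Qed.

Lemma hausdorff1_delta_sigma_subadditive delta :
  sigma_subadditive (hausdorff1_delta delta).
Proof.
move=> A; have [[i ioo]|] := pselect (exists i, hausdorff1_delta delta (A i) = +oo).
  rewrite (eseries_pinfty _ _ ioo) ?leey// => k _.
  by rewrite -ltNye (lt_le_trans _ (hausdorff1_delta_ge0 _ _)).
rewrite -forallNE => Aoo.
apply/lee_addgt0Pr => e e0.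
rewrite (le_trans _ (epsilon_trick _ _ (ltW e0)))//; last first.
  by move=> k; exact: hausdorff1_delta_ge0.
pose P k F := delta_cover delta (A k) F /\
  \sum_(j <oo) diam (F j) <= hausdorff1_delta delta (A k) + (e / (2 ^ k.+1)%:R)%:E.
have [G PG] : {G : ((set 'rV[R]_n)^nat)^nat & forall k, P k (G k)}.
  apply: (@choice _ _ P) => k.
  have Afin : hausdorff1_delta delta (A k) \is a fin_num.
    by rewrite ge0_fin_numE ?hausdorff1_delta_ge0// ltey; apply/eqP.
  have ek : (0 < e / (2 ^ k.+1)%:R)%R by rewrite divr_gt0// ltr0n expn_gt0.
  have [_ [F dF <-] /ltW FA] := lb_ereal_inf_adherent ek Afin.
  by exists F.
have dG_ge0 x : 0 <= (diam \o uncurry G) x by exact: diam_ge0.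
apply: (@le_trans _ _ (\esum_(i in setT) (diam \o uncurry G) i)).
  apply: ereal_inf_lbound => /=.
  have /card_esym/ppcard_eqP[f] := card_nat2.
  exists (uncurry G \o f).
    split => [i|]; first by rewrite /=; case: (f i) => a b; exact: (PG a).1.1.
    move=> t [i _ /(PG i).1.2 [j _ Gijt]].
    by exists (f^-1%FUN (i, j)) => //=; rewrite invK ?inE.
  rewrite -(esum_pred_image (diam \o uncurry G) _ xpredT) ?[fun=> _]set_true//.
  by rewrite image_eq.
rewrite (_ : esum _ _ = \sum_(i <oo) \sum_(j <oo) diam (G i j)); last first.
  pose J : nat -> set (nat * nat) := fun i => [set (i, j) | j in setT].
  rewrite (_ : setT = \bigcup_k J k); last first.
    by rewrite predeqE => -[a b]; split => // _; exists a => //; exists b.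
  rewrite esum_bigcupT /=; last 2 first.
    - apply/trivIsetP => i j _ _ ij.
      apply/seteqP; split => // -[k m] [[a _ [ik _]] [b _ [jk _]]].
      by move/eqP : ij; rewrite ik jk.
    - by move=> /= [k m]; exact: diam_ge0.
  rewrite -(image_id [set: nat]) -fun_true esum_pred_image//; last first.
    by move=> k _; apply: esum_ge0 => ? _; exact: diam_ge0.
  apply: eq_eseriesr => /= j _.
  rewrite -(esum_pred_image (diam \o uncurry G) (pair j) predT)//=; last 2 first.
    - by move=> k _; exact: diam_ge0.
    - by move=> ? ? _ _; exact: (@can_inj _ _ _ snd).
  by congr esum; rewrite predeqE => -[a b]; split; move=> [i _ <-]; exists i.
apply: lee_nneseries => k _; last exact: (PG k).2.
by move=> _; apply: nneseries_ge0 => m _ _; exact: diam_ge0.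
Qed.

Lemma hausdorff1_delta_le delta A :
  (0 < delta)%R -> hausdorff1_delta delta A <= hausdorff1 A.
Proof. by move=> d0; apply: ereal_sup_ubound; exists delta. Qed.

Lemma hausdorff1_0 : hausdorff1 set0 = 0.
Proof.
apply/eqP; rewrite eq_le; apply/andP; split.
  by apply: ge_ereal_sup => _ [d /= d0 <-]; rewrite hausdorff1_delta0.
exact: (le_trans (hausdorff1_delta_ge0 1%R _) (hausdorff1_delta_le _ _)).
Qed.

Lemma hausdorff1_ge0 A : 0 <= hausdorff1 A.
Proof.
exact: (le_trans (hausdorff1_delta_ge0 1%R _) (hausdorff1_delta_le _ _)).
Qed.

Lemma le_hausdorff1 : {homo hausdorff1 : A B / A `<=` B >-> A <= B}.
Proof.
move=> A B AB; apply: ge_ereal_sup => _ [d /= d0 <-].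
apply: (@le_trans _ _ (hausdorff1_delta d B)).
  exact: le_hausdorff1_delta.
exact: hausdorff1_delta_le.
Qed.

Lemma hausdorff1_sigma_subadditive : sigma_subadditive hausdorff1.
Proof.
move=> A; apply: ge_ereal_sup => _ [d /= d0 <-].
apply: le_trans (hausdorff1_delta_sigma_subadditive _ _) _.
apply: lee_nneseries => k _; last exact: hausdorff1_delta_le.
by move=> _; exact: hausdorff1_delta_ge0.
Qed.

HB.instance Definition _ := isOuterMeasure.Build R 'rV[R]_n hausdorff1
  hausdorff1_0 hausdorff1_ge0 le_hausdorff1 hausdorff1_sigma_subadditive.

(* 'rV[R]_n with the Caratheodory sigma-algebra of hausdorff1 *)
Definition H1_space : measurableType hausdorff1.-cara :=
  @caratheodory_type R 'rV[R]_n hausdorff1.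

Definition H1 : {measure set H1_space -> \bar R} :=
  (hausdorff1 : {outer_measure set 'rV[R]_n -> \bar R}).

End hausdorff.

Section weak_tangent.
Context {R : realType} {n : nat}.
Implicit Types (X : set 'rV[R]_n) (x : 'rV[R]_n).

(* Only the values of s on ]0, rho[ matter. *)
Definition weak_approx_1tangent X x : Prop :=
  exists (rho : R) (s : R -> 'rV[R]_n),
    [/\ 0 < rho,
        forall r : R, 0 < r < rho -> esphere (s r) &
        forall eps : R, 0 < eps ->
          (hausdorff1 ((X `\` double_cone (s r) eps x) `&` eclosed_ball x r)
             / (2 * r)%:E)%E @[r --> 0^'+] --> 0%E].

End weak_tangent.

Section curvature.
Context {R : realType} {n : nat}.
Implicit Types (X : set 'rV[R]_n) (x y z v w c : 'rV[R]_n) (p : R).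
Local Open Scope ereal_scope.

Definition affine_hull3 x y z : set 'rV[R]_n :=
  [set c | exists a b : R, c = (x + a *: (y - x) + b *: (z - x))%R].

(* The affine hull confines c to the plane of the triangle: without it, centres of
   spheres through x, y, z would qualify when n > 2. *)
Definition circumcenter x y z : set 'rV[R]_n :=
  [set c | affine_hull3 x y z c /\ edist c x = edist c y /\ edist c x = edist c z].

(* For three non-collinear points there is exactly one circumcenter; for three
   distinct collinear points there is none, and the infimum is +oo. *)
Definition circumradius x y z : \bar R :=
  ereal_inf [set (edist c x)%:E | c in circumcenter x y z].

(* Below, ^-1 is the inverse on \bar R: 0^-1 = +oo and +oo^-1 = 0. *)
Definition kappa X x y z : \bar R :=
  if [&& x \in X, y \in X, z \in X, x != y, y != z & x != z]
  then (circumradius x y z)^-1 else 0.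

Definition kappa_i X x y : \bar R :=
  if x != y
  then (ereal_inf [set circumradius x y w | w in X `\` [set x; y]])^-1 else 0.

Definition kappa_G X x : \bar R :=
  (ereal_inf [set r | exists v w, [/\ X v, X w, x != v, v != w & x != w] /\
                                  r = circumradius x v w])^-1.

Definition energy_U p X : \bar R :=
  \int[H1]_(x in X) (kappa_G X x `^ p).

Definition energy_I p X : \bar R :=
  \int[H1]_(y in X) \int[H1]_(x in X) (kappa_i X x y `^ p).

Definition energy_M p X : \bar R :=
  \int[H1]_(z in X) \int[H1]_(y in X) \int[H1]_(x in X) (kappa X x y z `^ p).

End curvature.

Definition E_set (R : realType) : set 'rV[R]_2 :=
  [set x | -1 <= x ord0 ord0 <= 1 /\ x ord0 ord_max = 0] `|`
  [set x | x ord0 ord0 = 0 /\ 0 <= x ord0 ord_max <= 1].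

Arguments E_set : clear implicits.

(* Main.v *)
(** Points of [E] lying on different axes at distances [a] and [b] from the origin are
    at distance [sqrt (a^2 + b^2)]. A circle of radius [R] through three distinct points
    of [E] contains points of both axes, hence [2 R] is at least the norm of each of these points. All
    three curvatures are therefore at most [2 / |w|] for every point [w] involved,
    and splitting the exponent evenly bounds the energies by powers of
    [\int_E (2 / |w|)^q dH^1] with [q = p, p/2, p/3 < 1]. This integral is finite since
    [H^1(E \cap B_r) <= 4 r].

    At the origin, a unit vector has a coordinate of absolute value at most [4/5], so the
    double cone of opening [acos (4/5)] around it misses the corresponding half axis,
    which carries [H^1]-measure at least [r/2] in [B_r]. *)

From mathcomp Require Import all_boot all_order all_algebra.
From mathcomp Require Import all_classical all_reals all_analysis.
From mathcomp Require Import measurable_realfun ring lra.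
Require Import Defs.

Import Order.TTheory GRing.Theory Num.Theory.
Set Implicit Arguments.
Unset Strict Implicit.
Local Open Scope ring_scope.
Local Open Scope classical_set_scope.

(** * Euclidean norm and coordinates *)

Section euclidean_facts.
Context {R : realType} {n : nat}.
Implicit Types x y u v : 'rV[R]_n.

Lemma edot_ge0 u : 0 <= edot u u.
Proof. by apply: sumr_ge0 => i _; rewrite -expr2 sqr_ge0. Qed.

Lemma enorm_ge0 u : 0 <= enorm u.
Proof. exact: sqrtr_ge0. Qed.

Lemma sqr_enorm u : enorm u ^+ 2 = edot u u.
Proof. by rewrite sqr_sqrtr ?edot_ge0. Qed.

Lemma enormN u : enorm (- u) = enorm u.
Proof.
by rewrite /enorm /edot; congr Num.sqrt; apply: eq_bigr => i _; rewrite mxE mulrNN.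
Qed.

Lemma le_coord_enorm u i : `|u ord0 i| <= enorm u.
Proof.
rewrite -(@ler_pXn2r _ 2)// ?nnegrE ?enorm_ge0// sqr_enorm real_normK ?num_real//.
rewrite /edot (bigD1 i)//= -expr2 lerDl.
by apply: sumr_ge0 => j _; rewrite -expr2 sqr_ge0.
Qed.

Lemma enorm_gt0 u : u != 0 -> 0 < enorm u.
Proof.
apply: contraNT; rewrite -leNgt => u0; apply/eqP/rowP => i; rewrite mxE.
by apply/eqP; rewrite -normr_le0 (le_trans (le_coord_enorm u i)).
Qed.

Lemma lipschitz_coord i x y : `|x ord0 i - y ord0 i| <= edist x y.
Proof. by have := le_coord_enorm (x - y) i; rewrite !mxE. Qed.

End euclidean_facts.

(** * Circles through three points of the axes, and the resulting curvature bounds *)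

Section plane.
Context {R : realType}.
Implicit Types c u v w x y z : 'rV[R]_2.

Lemma edot2E u v : edot u v = u ord0 ord0 * v ord0 ord0 + u ord0 ord_max * v ord0 ord_max.
Proof.
by rewrite /edot !big_ord_recl big_ord0 addr0; congr (_ + u _ _ * v _ _); exact: val_inj.
Qed.

Lemma row2P u v : u ord0 ord0 = v ord0 ord0 -> u ord0 ord_max = v ord0 ord_max -> u = v.
Proof.
move=> e0 e1; apply/rowP => -[[|[|//]] i].
- by rewrite (_ : Ordinal i = ord0)//; exact: val_inj.
- by rewrite (_ : Ordinal i = ord_max)//; exact: val_inj.
Qed.

Definition axes : set 'rV[R]_2 := [set x | x ord0 ord0 = 0 \/ x ord0 ord_max = 0].

(* The distance between points of different axes is at most 2R, and it is at
   least the distance of each of them to the origin. *)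
Lemma cross_axes_circle c u v :
  u ord0 ord_max = 0 -> v ord0 ord0 = 0 -> edist c u = edist c v ->
  enorm u <= 2 * edist c u /\ enorm v <= 2 * edist c u.
Proof.
move=> u1 v0 cuv.
have cu : edist c u ^+ 2 = edot (c - u) (c - u) by rewrite sqr_enorm.
have cv : edist c u ^+ 2 = edot (c - v) (c - v) by rewrite cuv sqr_enorm.
rewrite !edot2E !mxE u1 in cu; rewrite !edot2E !mxE v0 in cv.
have r0 : 0 <= edist c u by exact: enorm_ge0.
split; rewrite -(@ler_pXn2r _ 2)// ?nnegrE ?enorm_ge0 ?mulr_ge0//.
all: rewrite sqr_enorm edot2E ?u1 ?v0.
(* With [d = edist c u], twice the sum of [cu] and [cv] reads [4 d^2 = (2 c_0 - u_0)^2 + (2 c_1 -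
   v_1)^2 + u_0^2 + v_1^2]. *)
all: have := sqr_ge0 (2 * c ord0 ord0 - u ord0 ord0).
all: have := sqr_ge0 (2 * c ord0 ord_max - v ord0 ord_max).
all: have := sqr_ge0 (u ord0 ord0); have := sqr_ge0 (v ord0 ord_max).
all: rewrite exprMn; lra.
Qed.

(** A circle meets a line in at most two points: on either axis, the free coordinate of a point at
    given distance from [c] solves a quadratic equation. *)
Lemma equidistant_collinear c x y z : x != y -> y != z -> x != z ->
  edist c x = edist c y -> edist c x = edist c z ->
  ~ (x ord0 ord0 = 0 /\ y ord0 ord0 = 0 /\ z ord0 ord0 = 0) /\
  ~ (x ord0 ord_max = 0 /\ y ord0 ord_max = 0 /\ z ord0 ord_max = 0).
Proof.
move=> xy yz xz cxy cxz.
have cx : edist c x ^+ 2 = edot (c - x) (c - x) by rewrite sqr_enorm.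
have cy : edist c x ^+ 2 = edot (c - y) (c - y) by rewrite cxy sqr_enorm.
have cz : edist c x ^+ 2 = edot (c - z) (c - z) by rewrite cxz sqr_enorm.
rewrite !edot2E !mxE in cx cy cz.
(* Subtracting the equations and factoring gives [a + b = 2 e = a + d], hence [b = d]. *)
have key (a b d e f r : R) : r = (e - a) * (e - a) + f ->
    r = (e - b) * (e - b) + f -> r = (e - d) * (e - d) + f ->
    a != b -> b != d -> a != d -> False.
  rewrite -(subr_eq0 a) -(subr_eq0 b) -(subr_eq0 a d) => h1 h2 h3 ab bd ad.
  have e1 : (a - b) * (a + b - 2 * e) = 0 by lra.
  have e2 : (a - d) * (a + d - 2 * e) = 0 by lra.
  have {}e1 : a + b - 2 * e = 0 by apply: (mulfI ab); rewrite e1 mulr0.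
  have {}e2 : a + d - 2 * e = 0 by apply: (mulfI ad); rewrite e2 mulr0.
  by move/eqP: bd; apply; lra.
split=> -[x0 [y0 z0]]; rewrite x0 in cx; rewrite y0 in cy; rewrite z0 in cz.
(* On the vertical axis the constant summand comes first; swapping yields the form of [key]. *)
- rewrite [RHS]addrC in cx; rewrite [RHS]addrC in cy; rewrite [RHS]addrC in cz.
  apply: (key _ _ _ _ _ _ cx cy cz).
  + by apply: contraNN xy => /eqP e; apply/eqP/row2P; rewrite ?x0.
  + by apply: contraNN yz => /eqP e; apply/eqP/row2P; rewrite ?y0.
  + by apply: contraNN xz => /eqP e; apply/eqP/row2P; rewrite ?x0.
- apply: (key _ _ _ _ _ _ cx cy cz).
  + by apply: contraNN xy => /eqP e; apply/eqP/row2P; rewrite ?x0.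
  + by apply: contraNN yz => /eqP e; apply/eqP/row2P; rewrite ?y0.
  + by apply: contraNN xz => /eqP e; apply/eqP/row2P; rewrite ?x0.
Qed.

(** By [equidistant_collinear] the three points do not share an axis, so [w] can be paired with a
    point of the other axis, and [cross_axes_circle] applies to this pair. *)
Lemma enorm_le_diameter c x y z w : axes x -> axes y -> axes z ->
  x != y -> y != z -> x != z ->
  edist c x = edist c y -> edist c x = edist c z ->
  [set x; y; z] w -> enorm w <= 2 * edist c x.
Proof.
move=> ax ay az xy yz xz cxy cxz.
have [nv nh] := equidistant_collinear xy yz xz cxy cxz.
have cyz : edist c y = edist c z by rewrite -cxy.
have X u v := @cross_axes_circle c u v.
move=> [[|]|] -> {w}.
all: case: ax => ax; case: ay => ay; case: az => az; try tauto.
all: try by have [] := X _ _ ax ay cxy.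
all: try by have [] := X _ _ ay ax (esym cxy); rewrite -?cxy.
all: try by have [] := X _ _ ax az cxz.
all: try by have [] := X _ _ az ax (esym cxz); rewrite -?cxz.
all: try by have [] := X _ _ ay az cyz; rewrite -?cxy.
all: try by have [] := X _ _ az ay (esym cyz); rewrite -?cxz.
Qed.

Local Open Scope ereal_scope.

(** Every centre obeys the bound; if there is none, the infimum is [+oo]. *)
Lemma circumradius_ge x y z w : axes x -> axes y -> axes z ->
  x != y -> y != z -> x != z -> [set x; y; z] w ->
  (enorm w / 2)%:E <= circumradius x y z.
Proof.
move=> ax ay az xy yz xz xyzw; apply: le_ereal_inf_tmp => _ [c [_ [cxy cxz]] <-].
have := enorm_le_diameter ax ay az xy yz xz cxy cxz xyzw.
by rewrite lee_fin ler_pdivrMr ?ltr0n// mulrC.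
Qed.

Lemma inve_le_enorm w (r : \bar R) : w != 0%R -> (enorm w / 2)%:E <= r ->
  r^-1 <= (2 / enorm w)%:E.
Proof.
move=> /enorm_gt0 w0 wr.
have w2 : (0 < enorm w / 2)%R by rewrite divr_gt0.
have r0 : 0 <= r by rewrite (le_trans _ wr)// lee_fin ltW.
rewrite inve_ple ?inE//; last by rewrite lee_fin divr_ge0// ltW.
by rewrite inver gt_eqF ?divr_gt0// invf_div.
Qed.

Section curvature_bounds.
Variable X : set 'rV[R]_2.
Hypothesis Xaxes : X `<=` axes.

(** The free choice of [w] is what later lets the exponent be shared among the integration
    variables. *)
Lemma kappa_le x y z w : [set x; y; z] w -> w != 0%R ->
  kappa X x y z <= (2 / enorm w)%:E.
Proof.
move=> xyzw w0; rewrite /kappa; case: ifPn => [|_].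
  case/and5P => /set_mem/Xaxes ax /set_mem/Xaxes ay /set_mem/Xaxes az xy /andP[yz xz].
  by apply: inve_le_enorm => //; exact: circumradius_ge.
by rewrite lee_fin divr_ge0 ?enorm_ge0.
Qed.

Lemma kappa_i_le x y w : X x -> X y -> [set x; y] w -> w != 0%R ->
  kappa_i X x y <= (2 / enorm w)%:E.
Proof.
move=> /Xaxes ax /Xaxes ay xyw w0; rewrite /kappa_i; case: ifPn => [xy|_].
  apply: inve_le_enorm => //; apply: le_ereal_inf_tmp => _ [z [/Xaxes az /not_orP[zx zy]] <-].
  apply: circumradius_ge => //; last by left.
  - by apply/eqP => yz; exact: zy (esym yz).
  - by apply/eqP => xz; exact: zx (esym xz).
by rewrite lee_fin divr_ge0 ?enorm_ge0.
Qed.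

Lemma kappa_G_le x : X x -> x != 0%R -> kappa_G X x <= (2 / enorm x)%:E.
Proof.
move=> /Xaxes ax x0; apply: inve_le_enorm => //.
apply: le_ereal_inf_tmp => _ [v [w [[/Xaxes av /Xaxes aw xv vw xw] ->]]].
by apply: circumradius_ge => //; left; left.
Qed.

End curvature_bounds.

Lemma circumradius_ge0 x y z : 0 <= circumradius x y z.
Proof. by apply: le_ereal_inf_tmp => _ [c _ <-]; rewrite lee_fin enorm_ge0. Qed.

End plane.

(** * Upper and lower bounds for [hausdorff1] *)

Section hausdorff_estimates.
Context {R : realType} {n : nat}.
Implicit Types (A : set 'rV[R]_n).
Local Open Scope ereal_scope.

Lemma diam_le A (d : R) : (0 <= d)%R ->
  (forall x y, A x -> A y -> (edist x y <= d)%R) -> diam A <= d%:E.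
Proof.
move=> d0 Ad; rewrite /diam ge_max lee_fin d0/=.
by apply: ge_ereal_sup => _ [[x y] [/= Ax Ay] <-]; rewrite lee_fin Ad.
Qed.

Lemma edist_le_diam A x y : A x -> A y -> (edist x y)%:E <= diam A.
Proof.
by move=> Ax Ay; rewrite /diam le_max; apply/orP; right; apply: ereal_sup_ubound; exists (x, y).
Qed.

(** For each mesh [d], cutting the parameter interval into [N] pieces of length [L / N <= d] covers
    the image by [N] sets whose diameters add up to at most [L]. *)
Lemma hausdorff1_curve_le (phi : R -> 'rV[R]_n) (a L : R) : (0 <= L)%R ->
  (forall s t, (edist (phi s) (phi t) <= `|s - t|)%R) ->
  hausdorff1 (phi @` `[a, (a + L)%R]) <= L%:E.
Proof.
move=> L0 phi1; apply: ge_ereal_sup => _ [d /= d0 <-].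
pose N := (Num.truncn (L / d)).+1.
have N0 : (0 < N%:R :> R)%R by rewrite ltr0n.
have LN0 : (0 <= L / N%:R)%R by rewrite divr_ge0// ltW.
have LNd : (L / N%:R <= d)%R.
  by rewrite ler_pdivrMr// mulrC -ler_pdivrMr// ltW// truncnS_gt.
pose F k := if (k < N)%N then
  phi @` `[(a + k%:R * (L / N%:R))%R, (a + k.+1%:R * (L / N%:R))%R] else set0.
have dF k : diam (F k) <= if (k < N)%N then (L / N%:R)%:E else 0.
  rewrite /F; case: ifPn => _; last by rewrite diam0.
  apply: diam_le => // _ _ [s /= sI <-] [t /= tI <-].
  apply: le_trans (phi1 _ _) _; move: sI tI; rewrite !in_itv/= -natr1 => sI tI.
  by rewrite ler_norml; apply/andP; split; lra.
apply: (@le_trans _ _ (\sum_(k <oo) diam (F k))).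
  apply: ereal_inf_lbound; exists F => //; split.
    by move=> k; apply: le_trans (dF k) _; case: ifPn; rewrite lee_fin// ltW.
  move=> _ [t /= + <-]; rewrite in_itv/= => /andP[at_ ta].
  have [L00|L00] := eqVneq L 0%R.
    exists O => //; rewrite /F/=; exists t => //=.
    by rewrite in_itv/=; move: at_ ta; rewrite L00 !mul0r !mulr0 !addr0 => -> ->.
  have LN : (0 < L / N%:R)%R by rewrite divr_gt0// lt_neqAle eq_sym L00.
  (* The truncated quotient used below would give the right endpoint the index [N], one past the
     last piece. *)
  have [tL|tL] := eqVneq t (a + L)%R.
    exists N.-1 => //; rewrite /F /= ltnSn; exists t => //=.
    rewrite in_itv/= tL !lerD2l -[(Num.truncn _).+1]/N; apply/andP; split.
      by rewrite mulrCA ler_piMr// ler_pdivrMr// mul1r ler_nat.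
    by rewrite mulrCA divff ?mulr1// gt_eqF.
  have tLlt : (t < a + L)%R by rewrite lt_neqAle tL.
  have ta0 : (0 <= (t - a) / (L / N%:R))%R by rewrite divr_ge0 ?subr_ge0// ltW.
  exists (Num.truncn ((t - a) / (L / N%:R))) => //; rewrite /F ifT; last first.
    rewrite -(ltr_nat R); rewrite (@le_lt_trans _ _ ((t - a) / (L / N%:R))%R)// ?truncn_le//.
    rewrite ltr_pdivrMr// mulrCA divff ?mulr1 ?gt_eqF//; lra.
  exists t => //=; rewrite in_itv/=; have := Num.Theory.truncn_itv ta0.
  by rewrite ler_pdivlMr// ltr_pdivrMr// => /andP[? ?]; apply/andP; split; lra.
apply: (@le_trans _ _ (\sum_(k <oo) if (k < N)%N then (L / N%:R)%:E else 0)).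
  by apply: lee_nneseries => k *; [exact: diam_ge0|exact: dF].
rewrite (nneseries_split 0 N)/=; last by move=> k _; case: ifPn; rewrite ?lee_fin.
rewrite [X in _ + X]eseries0 ?adde0; last first.
  by move=> k /= Nk _; rewrite add0n in Nk; rewrite ltnNge Nk.
rewrite add0n big_mkord (eq_bigr (fun=> (L / N%:R)%:E)); last by move=> i _; rewrite ltn_ord.
by rewrite sumEFin sumr_const card_ord -(mulr_natr (L / _)) divfK// gt_eqF.
Qed.

(* Each set F of a cover is mapped into an interval of length at most 2 diam F. *)
Lemma le_hausdorff1_lipschitz_image (f : 'rV[R]_n -> R) A (a b : R) :
  (forall x y, (`|f x - f y| <= edist x y)%R) -> `[a, b] `<=` f @` A ->
  (b - a)%:E <= 2%:E * hausdorff1 A.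
Proof.
move=> f1 abA.
have [ab|ab] := leP b a.
  by rewrite (@le_trans _ _ 0) ?lee_fin ?subr_le0// mule_ge0// hausdorff1_ge0.
(* Mesh [1] suffices: the bound on the mesh serves only to make the diameters finite. *)
apply: (@le_trans _ _ (2%:E * hausdorff1_delta 1 A)); last first.
  by rewrite lee_pmul2l// hausdorff1_delta_le.
rewrite -lee_pdivrMl//.
apply: le_ereal_inf_tmp => _ [F [F1 AF] <-].
rewrite lee_pdivrMl//.
have Ffin k : diam (F k) \is a fin_num.
  by rewrite ge0_fin_numE ?diam_ge0// (le_lt_trans (F1 k)) ?ltry.
(* The centre is the image of some point of [F k]; the default [0] occurs only for empty [F k],
   where there is nothing to cover. *)
pose c k := f (xget 0%R (F k)).
pose I k : set R := `[(c k - fine (diam (F k)))%R, (c k + fine (diam (F k)))%R].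
have abI : `[a, b] `<=` \bigcup_k I k.
  move=> t /abA[x Ax <-]; have [k _ Fx] := AF _ Ax; exists k => //.
  rewrite /I /= in_itv/=; have := xgetPex 0%R (ex_intro _ x Fx); rewrite -/(c k) => Fc.
  have : (`|f x - c k| <= fine (diam (F k)))%R.
    by apply: le_trans (f1 _ _) _; rewrite -lee_fin fineK// edist_le_diam.
  by rewrite ler_norml => /andP[]; lra.
have -> : (b - a)%:E = lebesgue_measure (`[a, b] : set R).
  by rewrite lebesgue_measure_itv/= lte_fin ab.
apply: (@le_trans _ _ (\sum_(k <oo) lebesgue_measure (I k))).
  by apply: measure_sigma_subadditive => // k; exact: measurable_itv.
rewrite -nneseriesZl; last by move=> k _; exact: diam_ge0.
apply: lee_nneseries => k _ //.
rewrite /I lebesgue_measure_itv/=; case: ifPn => _; last by rewrite mule_ge0// diam_ge0.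
by rewrite -(fineK (Ffin k)) -EFinD -EFinM lee_fin; lra.
Qed.

End hausdorff_estimates.

(** * Dyadic layer bounds for the integral *)

Section layers.
Context {R : realType}.
Local Open Scope ereal_scope.

Import HBNNSimple.

(** By induction on [N]: once [s] exceeds [c 2^N], the new term [c 2^(N+1)] alone dominates it. *)
Lemma dyadic_layer_bound (s c : R) (N : nat) : (0 < c)%R -> (0 <= s <= c * 2 ^+ N)%R ->
  (s <= c * (0 < s)%R%:R + \sum_(k < N) c * 2 ^+ k.+1 * (c * 2 ^+ k < s)%R%:R)%R.
Proof.
move=> c0 /andP[s0]; elim: N => [|N IH] sN.
  rewrite big_ord0 addr0; move: s0; rewrite le_eqVlt => /predU1P[<-|s0].
    by rewrite ltxx mulr0.
  by rewrite s0 mulr1; rewrite expr0 mulr1 in sN.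
rewrite big_ord_recr/= addrA.
have [/IH sN'|sN'] := leP s (c * 2 ^+ N)%R.
  by rewrite mulr0 addr0.
rewrite mulr1 (le_trans sN)// lerDr addr_ge0 ?mulr_ge0 ?(ltW c0)//.
by apply: sumr_ge0 => k _; rewrite !mulr_ge0 ?exprn_ge0// ltW.
Qed.

(* The integral is a lower integral, so it is bounded layer by layer through the
   simple functions below f: neither f nor D needs to be measurable. *)
Lemma ge0_integral_le_layers d (T : measurableType d) (mu : {measure set T -> \bar R})
    (D : set T) (f : T -> \bar R) (c m0 B : R) (m : nat -> R) :
  (0 < c)%R -> (forall x, D x -> 0 <= f x) ->
  (forall A, measurable A -> A `<=` D -> mu A <= m0%:E) ->
  (forall k A, measurable A -> A `<=` D ->
    (forall x, A x -> (c * 2 ^+ k)%:E < f x) -> mu A <= (m k)%:E) ->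
  (forall N, c * m0 + \sum_(k < N) c * 2 ^+ k.+1 * m k <= B)%R ->
  \int[mu]_(x in D) f x <= B%:E.
Proof.
move=> c0 f0 muD muk mB; rewrite ge0_integralE//; apply: ge_ereal_sup => _ [s sf <-].
have sD x : (0 < s x)%R -> D x.
  move=> sx; have := sf x; rewrite patchE; case: ifPn => [/set_mem//|_].
  by rewrite lee_fin leNgt sx.
have sfD x : (0 < s x)%R -> (s x)%:E <= f x.
  by move=> sx; have := sf x; rewrite patchE mem_set//; exact: sD.
(* A simple function is bounded, so finitely many layers suffice. *)
have [N sN] : exists N, forall x, (s x <= c * 2 ^+ N)%R.
  have [M [_ sM]] := @simple_bounded _ _ _ s.
  have [N MN] : exists N, (M + 1 <= c * 2 ^+ N)%R.
    exists (Num.truncn ((M + 1) / c)).+1.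
    rewrite mulrC -ler_pdivrMr// ltW// (lt_le_trans (truncnS_gt _))//.
    by rewrite -natrX ler_nat ltnW// ltn_expl.
  exists N => x; apply: le_trans MN; apply: le_trans (ler_norm _) _.
  by apply: sM => //; rewrite ltrDl.
have mlt (r : R) : measurable [set x | (r < s x)%R].
  rewrite (_ : [set x | _] = s @^-1` `]r, +oo[); last first.
    by apply/seteqP; split => x /=; rewrite in_itv/= andbT.
  exact: measurable_funPTI.
rewrite -integralT_nnsfun.
(* Index [0] stands for the level [0] and index [k + 1] for the level [c 2^k], so that [g k] always
   has the coefficient [c 2^k]. *)
pose g k := indic_nnsfun R (mlt (if k is k'.+1 then c * 2 ^+ k' else 0)%R).
apply: (@le_trans _ _ (\int[mu]_x \sum_(k < N.+1) ((c * 2 ^+ k)%:E * (g k x)%:E))).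
  apply: ge0_le_integral => //.
  - by move=> x _; rewrite lee_fin.
  - exact/measurable_EFinP/measurable_funP.
  - apply: emeasurable_sum => k; apply: measurable_funeM.
    exact/measurable_EFinP/measurable_funP.
  - move=> x _; rewrite sumEFin lee_fin big_ord_recl expr0 mulr1.
    have := @dyadic_layer_bound (s x) c N c0; rewrite fun_ge0 sN => /(_ isT)/le_trans; apply.
    have memE r : (x \in [set y | (r < s y)%R]) = (r < s x)%R.
      by apply/idP/idP => [/set_mem|/mem_set].
    rewrite /g/= mindicE memE; under [in leRHS]eq_bigr do rewrite mindicE memE.
    exact: lexx.
rewrite ge0_integral_sum//=; last 2 first.
  - move=> k; apply: measurable_funeM.
    exact/measurable_EFinP/measurable_funP.
  - by move=> k x _; rewrite -EFinM lee_fin !mulr_ge0// ltW.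
apply: le_trans (_ : _ <= (c * m0 + \sum_(k < N) c * 2 ^+ k.+1 * m k)%:E) _; last first.
  by rewrite lee_fin.
have intE a (r : R) : (0 <= a)%R ->
    \int[mu]_x (a%:E * (indic_nnsfun R (mlt r) x)%:E) = a%:E * mu [set x | (r < s x)%R].
  move=> a0; rewrite ge0_integralZl//.
  - by rewrite integral_indic// setIT.
  - exact/measurable_EFinP/measurable_funP.
  - by move=> x _; rewrite lee_fin.
rewrite big_ord_recl EFinD -sumEFin; apply: leeD.
  rewrite intE ?mulr_ge0 ?exprn_ge0 ?(ltW c0)// expr0 mulr1 EFinM lee_pmul2l//.
  exact: muD.
apply: lee_sum => k _; rewrite intE ?mulr_ge0 ?exprn_ge0 ?(ltW c0)//.
rewrite [leRHS]EFinM lee_pmul2l ?lte_fin ?mulr_gt0 ?exprn_gt0//=.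
have ck0 : (0 < c * 2 ^+ k)%R by rewrite mulr_gt0 ?exprn_gt0.
apply: muk => //= x /= sx; first by apply: sD; exact: lt_trans sx.
by apply: lt_le_trans (sfD _ _); [rewrite lte_fin|exact: lt_trans sx].
Qed.

End layers.

(** * Half axes, double cones and the measure of the axes in a ball *)

Section axis.
Context {R : realType} {n : nat}.
Implicit Types (i : 'I_n) (s t : R) (v : 'rV[R]_n).

Lemma edot_axis i t v : edot (t *: 'e_i) v = t * v ord0 i.
Proof.
rewrite /edot (bigD1 i)//= big1 ?addr0 => [|j ji].
  by rewrite !mxE !eqxx mulr1.
by rewrite !mxE (negbTE ji) andbF mulr0 mul0r.
Qed.

Lemma enorm_axis i t : enorm (t *: 'e_i : 'rV[R]_n) = `|t|.
Proof. by rewrite /enorm edot_axis !mxE !eqxx mulr1 -expr2 sqrtr_sqr. Qed.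

Lemma edist_axis i s t : edist (s *: 'e_i : 'rV[R]_n) (t *: 'e_i) = `|s - t|.
Proof. by rewrite /edist -scalerBl enorm_axis. Qed.

Lemma angle_axis i t v : 0 < t -> enorm v = 1 -> angle (t *: 'e_i) 0 v = acos (v ord0 i).
Proof.
move=> t0 v1; rewrite /angle !subr0 edot_axis enorm_axis v1 mulr1 gtr0_norm//.
by rewrite mulrAC divff ?mul1r// gt_eqF.
Qed.

(** The half axis makes the angles [acos (v_i)] and [acos (- v_i)] with [v] and [- v]; since [acos]
    decreases, both are at least [acos a]. *)
Lemma axis_notin_double_cone i t (a : R) v : 0 <= t -> enorm v = 1 -> a <= 1 ->
  `|v ord0 i| <= a -> ~ double_cone v (acos a) 0 (t *: 'e_i).
Proof.
move=> t0 v1 a1 via [tn0].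
have {}t0 : 0 < t.
  by rewrite lt_neqAle t0 andbT; apply: contraNneq tn0 => <-; rewrite scale0r.
have vN1 : enorm (- v) = 1 by rewrite enormN.
have a0 : 0 <= a by exact: le_trans via.
have via' : - a <= v ord0 i <= a by rewrite -ler_norml.
have le_acos (x : R) : - a <= x <= a -> acos a <= acos x.
  move=> /andP[ax xa].
  have xI : -1 <= x <= 1 by apply/andP; split; lra.
  have aI : -1 <= a <= 1 by apply/andP; split; lra.
  rewrite leNgt -ltr_cos ?in_itv/= ?acos_ge0 ?acos_lepi//.
  by have [_ ->] := acos_def aI; have [_ ->] := acos_def xI; rewrite -leNgt.
rewrite sub0r add0r !angle_axis// mxE gt_min => /orP.
by rewrite !ltNge; case; rewrite le_acos// lerN2 lerNl andbC.
Qed.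

End axis.

(** Each axis contributes at most a segment of length [2 r]. *)
Lemma hausdorff1_axes_ball (R : realType) (r : R) : 0 <= r ->
  (hausdorff1 (axes `&` [set x : 'rV[R]_2 | (enorm x <= r)%R]) <= (4 * r)%:E)%E.
Proof.
move=> r0; pose S (i : 'I_2) : set 'rV[R]_2 :=
  (fun t : R => t *: 'e_i) @` `[- r, - r + 2 * r].
have S2 i : (hausdorff1 (S i) <= (2 * r)%:E)%E.
  by apply: hausdorff1_curve_le => [|s t]; rewrite ?mulr_ge0// edist_axis.
apply: (@le_trans _ _ (hausdorff1 (S ord0 `|` S ord_max))).
  apply: le_hausdorff1 => x [ax xr].
  have xI i : - r <= x ord0 i <= - r + 2 * r.
    have := le_trans (le_coord_enorm x i) xr.
    by rewrite ler_norml => /andP[? ?]; apply/andP; split; lra.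
  case: ax => x0; [right|left].
  - exists (x ord0 ord_max); first by rewrite /= in_itv/= xI.
    by apply: row2P; rewrite !mxE/= ?x0 ?mulr1 ?mulr0.
  - exists (x ord0 ord0); first by rewrite /= in_itv/= xI.
    by apply: row2P; rewrite !mxE/= ?x0 ?mulr1 ?mulr0.
apply: le_trans (outer_measureU2 _ _ _) _.
rewrite (_ : 4 * r = 2 * r + 2 * r)%R; last by ring.
rewrite EFinD; exact: leeD (S2 _) (S2 _).
Qed.

(** * Finiteness of the three energies *)

Section energies.
Context {R : realType}.
Local Open Scope ereal_scope.

(** With [b = 2^(1/q)], [f] exceeds [c 2^k] only within distance [2 / b^k] of the origin, on measure
    at most [8 / b^k]. The layers form a geometric series of ratio [2 / b], and [b > 2] because
    [q < 1]. As [K] depends on [q] alone, iterated integrals can be bounded one variable at a time,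
    the outer factors entering through [c]. *)
Lemma integral_axes_le (q : R) : (0 < q < 1)%R -> exists2 K : R, (0 < K)%R &
  forall (X : set 'rV[R]_2) (c : R) (f : 'rV[R]_2 -> \bar R),
    X `<=` axes -> (forall x, X x -> (enorm x <= 1)%R) -> (0 < c)%R ->
    (forall x, X x -> 0 <= f x) ->
    (forall x, X x -> x != 0%R -> f x <= (c * (2 / enorm x) `^ q)%:E) ->
    \int[H1]_(x in X) f x <= (c * K)%:E.
Proof.
move=> /andP[q0 q1]; pose b : R := (2 `^ q^-1)%R.
have bq : (b `^ q = 2)%R by rewrite /b -powRrM mulVf ?powRr1// gt_eqF.
have b0 : (0 < b)%R by rewrite powR_gt0.
have b2 : (2 < b)%R.
  have q1' : (0 < q^-1 - 1)%R by rewrite subr_gt0 invf_gt1.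
  rewrite /b -[X in (_ `^ X)%R](subrKC 1) powRD ?pnatr_eq0 ?implybT// powRr1//.
  by rewrite ltr_pMr// -[ltLHS](congr1 (@^~ (q^-1 - 1)%R) (powR1 R)) gt0_ltr_powR// ?nnegrE// ltr1n.
have t0 : (0 <= 2 / b)%R by rewrite divr_ge0// ltW.
have t1 : (0 < 1 - 2 / b)%R by rewrite subr_gt0 ltr_pdivrMr// mul1r.
(* [8] bounds the measure of [X], through the ball of radius [2]; [16 = 2 * 8] is the leading
   coefficient of the geometric series. *)
exists (8 + 16 / (1 - 2 / b))%R; first by rewrite addr_gt0// divr_gt0.
move=> X c f Xaxes X1 c0 f0 fle.
apply: (@ge0_integral_le_layers _ _ _ _ _ _ c 8 _ (fun k => 8 / b ^+ k)%R) => //.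
- move=> A _ AX; have := @hausdorff1_axes_ball R 2 (ler0n _ _).
  rewrite (_ : 4 * 2 = 8)%R; last by ring.
  apply: le_trans; apply: le_hausdorff1 => x Ax.
  by split; [exact/Xaxes/AX|rewrite /= (le_trans (X1 _ (AX _ Ax)))// ler1n].
- move=> k A _ AX Af.
  have bk : (0 < b ^+ k)%R by rewrite exprn_gt0.
  have := hausdorff1_axes_ball (divr_ge0 (ler0n R 2) (ltW bk)).
  rewrite (_ : 4 * _ = 8 / b ^+ k)%R; last by rewrite mulrA; congr (_ / _)%R; ring.
  apply: le_trans; apply: le_hausdorff1 => x Ax.
  split; first exact/Xaxes/AX.
  (* At the origin [f] may be infinite, but the origin lies in every ball. *)
  have [->|x0] := eqVneq (x : 'rV[R]_2) 0%R.
    by rewrite /= -(scale0r 'e_ord0) enorm_axis normr0 divr_ge0// ltW.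
  have nx := enorm_gt0 x0.
  have := lt_le_trans (Af _ Ax) (fle _ (AX _ Ax) x0).
  rewrite lte_fin ltr_pM2l//; apply: contraTT; rewrite -ltNge => xb.
  have {}xb : (2 / enorm x <= b ^+ k)%R.
    by rewrite ler_pdivrMr// mulrC -ler_pdivrMr// ltW.
  rewrite -leNgt; apply: le_trans (ge0_ler_powR (ltW q0) _ _ xb) _.
  + by rewrite nnegrE divr_ge0// ltW.
  + by rewrite nnegrE ltW.
  + by rewrite -powR_mulrn ?(ltW b0)// powRAC bq powR_mulrn.
- move=> N.
  have -> : (\sum_(k < N) c * 2 ^+ k.+1 * (8 / b ^+ k) =
      c * (16 * \sum_(k < N) (2 / b) ^+ k))%R.
    rewrite !mulr_sumr; apply: eq_bigr => k _; rewrite expr_div_n exprS; ring.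
  rewrite -mulrDr ler_pM2l// lerD2l ler_pM2l//.
  rewrite -[leRHS]mul1r ler_pdivlMr// mulrC.
  have -> : ((1 - 2 / b) * \sum_(k < N) (2 / b) ^+ k = 1 - (2 / b) ^+ N)%R.
    by rewrite -[RHS]opprB subrX1 -[RHS]mulNr opprB.
  by rewrite lerBlDr lerDl exprn_ge0.
Qed.

Lemma poweRD_le (k : \bar R) (p q a b : R) : 0 <= k -> (0 < p)%R -> (0 < q)%R ->
  k `^ p <= a%:E -> k `^ q <= b%:E -> k `^ (p + q) <= (a * b)%:E.
Proof.
move=> k0 p0 q0 ka kb; rewrite poweRD ?add_neq0_poweRD_def ?gt_eqF ?addr_gt0//.
by rewrite EFinM lee_pmul// poweR_ge0.
Qed.

Lemma poweR_le (k : \bar R) (p a : R) : 0 <= k -> (0 < p)%R ->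
  k <= a%:E -> k `^ p <= (a `^ p)%:E.
Proof.
move=> k0 p0 ka; rewrite -poweR_EFin; apply: gt0_ler_poweR => //; first exact: ltW.
- by rewrite in_itv/= k0 leey.
- by rewrite in_itv/= leey andbT (le_trans k0).
Qed.

Lemma kappa_ge0 (X : set 'rV[R]_2) x y z : 0 <= kappa X x y z.
Proof. by rewrite /kappa; case: ifPn => // _; rewrite inve_ge0 circumradius_ge0. Qed.

Lemma kappa_i_ge0 (X : set 'rV[R]_2) x y : 0 <= kappa_i X x y.
Proof.
rewrite /kappa_i; case: ifPn => // _; rewrite inve_ge0.
by apply: le_ereal_inf_tmp => _ [w _ <-]; exact: circumradius_ge0.
Qed.

Lemma kappa_G_ge0 (X : set 'rV[R]_2) x : 0 <= kappa_G X x.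
Proof.
rewrite inve_ge0.
by apply: le_ereal_inf_tmp => _ [v [w [_ ->]]]; exact: circumradius_ge0.
Qed.

Variable X : set 'rV[R]_2.
Hypotheses (Xaxes : X `<=` axes) (X1 : forall x, X x -> (enorm x <= 1)%R).

Let g (q : R) (x : 'rV[R]_2) : R := ((2 / enorm x) `^ q)%R.

Let g_gt0 q x : x != 0%R -> (0 < g q x)%R.
Proof. by move=> x0; rewrite powR_gt0// divr_gt0// enorm_gt0. Qed.

Lemma energy_U_lty (p : R) : (0 < p < 1)%R -> energy_U p X < +oo.
Proof.
move=> p01; have [K K0 intK] := integral_axes_le p01.
case/andP: p01 => p0 _.
apply: (@le_lt_trans _ _ (1 * K)%:E); last exact: ltry.
apply: (intK X) => // x Xx; first by move=> *; exact: poweR_ge0.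
by move=> x0; rewrite mul1r; apply: poweR_le (kappa_G_le _ _ _) => //; exact: kappa_G_ge0.
Qed.

Lemma energy_I_lty (p : R) : (0 < p < 2)%R -> energy_I p X < +oo.
Proof.
move=> /andP[p0 p2]; pose q := (p / 2)%R.
have q0 : (0 < q)%R by rewrite divr_gt0.
have q01 : (0 < q < 1)%R by rewrite q0 ltr_pdivrMr// mul1r.
have [K K0 intK] := integral_axes_le q01.
have kle x y : X x -> X y -> x != 0%R -> y != 0%R ->
    kappa_i X x y `^ p <= (g q y * g q x)%:E.
  move=> Xx Xy x0 y0; rewrite (_ : p = q + q)%R; last by rewrite /q; field.
  have k0 := kappa_i_ge0 X x y.
  by apply: poweRD_le => //; apply: poweR_le => //; apply: kappa_i_le => //; [right|left].
apply: (@le_lt_trans _ _ (K * K)%:E); last exact: ltry.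
apply: (intK X) => // y Xy; first by apply: integral_ge0 => *; exact: poweR_ge0.
(* For fixed [y], the factor [g q y] is the constant [c] of the inner integral. *)
move=> y0; rewrite [(K * _)%R]mulrC; apply: (intK X) => //.
- exact: g_gt0.
- by move=> *; exact: poweR_ge0.
- by move=> *; exact: kle.
Qed.

Lemma energy_M_lty (p : R) : (0 < p < 3)%R -> energy_M p X < +oo.
Proof.
move=> /andP[p0 p3]; pose q := (p / 3)%R.
have q0 : (0 < q)%R by rewrite divr_gt0.
have q01 : (0 < q < 1)%R by rewrite q0 ltr_pdivrMr// mul1r.
have [K K0 intK] := integral_axes_le q01.
have kle x y z : x != 0%R -> y != 0%R -> z != 0%R ->
    kappa X x y z `^ p <= (g q z * g q y * g q x)%:E.
  move=> x0 y0 z0; rewrite (_ : p = q + q + q)%R; last by rewrite /q; field.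
  have k0 := kappa_ge0 X x y z.
  apply: poweRD_le => //; rewrite ?addr_gt0//; last first.
    by apply: poweR_le => //; apply: kappa_le => //; left; left.
  by apply: poweRD_le => //; apply: poweR_le => //; apply: kappa_le => //; [right|left; right].
apply: (@le_lt_trans _ _ (K * K * K)%:E); last exact: ltry.
apply: (intK X) => //; first exact: mulr_gt0.
  by move=> z Xz; apply: integral_ge0 => *; apply: integral_ge0 => *; exact: poweR_ge0.
(* The constant [c] is [K * K] for the outer integral, [g q z * K] for the middle one and
   [g q z * g q y] for the inner one. *)
move=> z Xz z0; rewrite (_ : K * K * _ = g q z * K * K)%R; last by rewrite /g; ring.
apply: (intK X) => //; first by rewrite mulr_gt0// g_gt0.
  by move=> y Xy; apply: integral_ge0 => *; exact: poweR_ge0.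
move=> y Xy y0; rewrite -/(g q y) mulrAC; apply: (intK X) => //.
- by rewrite mulr_gt0// g_gt0.
- by move=> *; exact: poweR_ge0.
- by move=> *; exact: kle.
Qed.

End energies.

(** * The set [E] and its failure to have a weak tangent at the origin *)

Lemma E_set_axes (R : realType) : E_set R `<=` axes.
Proof. by move=> x [[_ ?]|[? _]]; [right|left]. Qed.

Lemma E_set_enorm_le1 (R : realType) x : E_set R x -> enorm x <= 1.
Proof.
have sq (a : R) : -1 <= a <= 1 -> a * a <= 1.
  by move=> /andP[? ?]; nra.
move=> Ex; rewrite -(@ler_pXn2r _ 2)// ?nnegrE ?enorm_ge0// sqr_enorm edot2E expr1n.
case: Ex => -[] => [xI ->|-> /andP[x0 x1]]; rewrite mulr0 ?addr0 ?add0r; apply: sq => //.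
by rewrite x1 andbT; lra.
Qed.

(** The unit segments in the two positive directions are all of [E] that the tangent argument
    uses. *)
Lemma E_set_axis (R : realType) i (t : R) : 0 <= t <= 1 -> E_set R (t *: 'e_i).
Proof.
move=> /andP[t0 t1].
case: i => -[|[|//]] i; [left|right]; rewrite /= !mxE/= mulr1 mulr0; split => //.
- by apply/andP; split => //; lra.
- by apply/andP; split.
Qed.

Lemma E_set_not_weak_approx_1tangent (R : realType) :
  ~ weak_approx_1tangent (E_set R) 0.
Proof.
move=> [rho [s [rho0 sS lim0]]].
(* Two coordinates above [a] in absolute value would give a squared norm above [32 / 25 > 1], while
   [a < 1] keeps the opening [acos a] positive. *)
pose a : R := 4 / 5.
have a0 : 0 < a by rewrite /a; lra.
have a1 : a < 1 by rewrite /a; lra.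
have /lim0 {}lim0 : 0 < acos a by apply: acos_gt0; apply/andP; split; lra.
suff : ((1 / 4)%:E <= 0%:E :> \bar R)%E by rewrite lee_fin; lra.
apply: cvge_to_ge lim0 _.
near=> r.
have r0 : 0 < r by near: r; exact: nbhs_right_gt.
have r1 : r <= 1 by near: r; exact: nbhs_right_ltW.
have rr : r < rho by near: r; exact: nbhs_right_lt.
have s1 : enorm (s r) = 1 by apply: sS; rewrite r0.
have [i si] : exists i, `|s r ord0 i| <= a.
  have : edot (s r) (s r) = 1 by rewrite -sqr_enorm s1 expr1n.
  rewrite edot2E => h.
  have [?|s0] := leP `|s r ord0 ord0| a; first by exists ord0.
  have [?|s0'] := leP `|s r ord0 ord_max| a; first by exists ord_max.
  have sq (x : R) : a < `|x| -> a ^+ 2 < x * x.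
    by move=> ax; rewrite -expr2 -[ltRHS]real_normK ?num_real// ltrXn2r// ltW.
  by have := sq _ s0; have := sq _ s0'; rewrite /a; lra.
(* The [i]-th coordinate is 1-Lipschitz, and its values on the part of [E] outside the cone and in
   the ball cover [[0, r]]. *)
have := @le_hausdorff1_lipschitz_image _ _ (fun x : 'rV[R]_2 => x ord0 i)
  ((E_set R `\` double_cone (s r) (acos a) 0) `&` eclosed_ball 0 r) 0 r
  (lipschitz_coord i).
set H := hausdorff1 _; rewrite subr0 => rH.
have {}rH : (r%:E <= 2%:E * H)%E.
  apply: rH => t /=; rewrite in_itv/= => /andP[t0 tr].
  exists (t *: 'e_i); last by rewrite !mxE !eqxx mulr1.
  split; last by rewrite /= /eclosed_ball/= -(scale0r 'e_i) edist_axis subr0 ger0_norm.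
  split; first by apply: E_set_axis; rewrite t0 (le_trans tr).
  by apply: axis_notin_double_cone => //; lra.
have r20 : (0 < 2 * r) by lra.
rewrite inver gt_eqF// lee_pdivlMr//.
rewrite -(@lee_pmul2l _ 2%:E)//; apply: le_trans rH.
by rewrite -!EFinM lee_fin; lra.
Unshelve. all: by end_near.
Qed.

Theorem lemma8p1 (R : realType) :
  [/\ ~ weak_approx_1tangent (E_set R) 0,
      forall p : R, 0 < p < 1 -> (energy_U p (E_set R) < +oo)%E,
      forall p : R, 0 < p < 2 -> (energy_I p (E_set R) < +oo)%E &
      forall p : R, 0 < p < 3 -> (energy_M p (E_set R) < +oo)%E].
Proof.
have ax := @E_set_axes R; have n1 := @E_set_enorm_le1 R.
split; first exact: E_set_not_weak_approx_1tangent.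
- by move=> p; exact: energy_U_lty.
- by move=> p; exact: energy_I_lty.
- by move=> p; exact: energy_M_lty.
Qed.
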